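(* In the category $\mathsf{LPM}$ of left pseudocancellative unital magmas, every subalgebra of a protomodular object is weakly protomodular (as an object of $\mathsf{LPM}$).
   Context: A left pseudocancellative unital magma (LPM) is a set $X$ with two binary operations $*$ and $\backslash$ and a nullary operation (constant) $e\in X$ satisfying, for all $x,y\in X$, the identities $y = x*(x\backslash y)$ and $x = e*x = x*e$. The category $\mathsf{LPM}$ has LPMs as objects and maps preserving $*$, $\backslash$ and $e$ as morphisms; it is a pointed variety of universal algebras (the zero object is the one-element algebra). A subalgebra is a subset containing $e$ and closed under $*$ and $\backslash$. In a pointed finitely complete category $\mathcal{C}$, two morphisms $f\colon A\to C$ and $g\colon B\to C$ are jointly extremal-epimorphic if, whenever both factor through a common monomorphism $m\colon M\to C$, then $m$ is an isomorphism (in a variety: $C$ is generated as an algebra by the images of $f$ and $g$). A point over $X$ is a pair $(f\colon A\to X,\ s\colon X\to A)$ with $f\circ s=1_X$. It is strong if $s$ and the kernel $k\colon K\to A$ of $f$ are jointly extremal-epimorphic. It is stably strong if for every morphism $g\colon Z\to X$ the pulled-back point $(\pi_Z\colon Z\times_X A\to Z,\ \langle 1_Z, s\circ g\rangle\colon Z\to Z\times_X A)$ is strong. An object $X$ is weakly protomodular in $\mathcal{C}$ if every point over $X$ is strong, and protomodular in $\mathcal{C}$ if every point over $X$ is stably strong. *)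

(* Defs.v *)
From Stdlib Require Import FunctionalExtensionality ProofIrrelevance.

Set Implicit Arguments.
Unset Strict Implicit.

Declare Scope cat_scope.
Delimit Scope cat_scope with cat.
Open Scope cat_scope.

Record category := Category {
  ob :> Type;
  hom : ob -> ob -> Type;
  idm : forall A : ob, hom A A;
  comp : forall A B C : ob, hom B C -> hom A B -> hom A C;
  comp_idl : forall (A B : ob) (f : hom A B), comp (idm B) f = f;
  comp_idr : forall (A B : ob) (f : hom A B), comp f (idm A) = f;
  comp_assoc : forall (A B C D : ob) (h : hom C D) (g : hom B C) (f : hom A B),
    comp h (comp g f) = comp (comp h g) f
}.

Arguments hom {c} A B.
Arguments idm {c} A.
Arguments comp {c A B C} g f.

Notation "g ∘ f" := (comp g f) (at level 40, left associativity) : cat_scope.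

Definition is_terminal (C : category) (T : C) : Prop :=
  forall A : C, exists f : hom A T, forall g : hom A T, g = f.

Definition is_initial (C : category) (I : C) : Prop :=
  forall A : C, exists f : hom I A, forall g : hom I A, g = f.

Definition is_zero_object (C : category) (O : C) : Prop :=
  is_initial O /\ is_terminal O.

Definition is_pullback (C : category) (A B D P : C)
    (f : hom A D) (g : hom B D) (p1 : hom P A) (p2 : hom P B) : Prop :=
  f ∘ p1 = g ∘ p2 /\
  forall (Q : C) (q1 : hom Q A) (q2 : hom Q B), f ∘ q1 = g ∘ q2 ->
    exists u : hom Q P, (p1 ∘ u = q1 /\ p2 ∘ u = q2) /\
      forall v : hom Q P, p1 ∘ v = q1 -> p2 ∘ v = q2 -> v = u.

(* A terminal object together with pullbacks gives all finite limits. *)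
Record pfc_category := PfcCategory {
  pfc_cat :> category;
  pfc_zero : exists O : pfc_cat, is_zero_object O;
  pfc_pullback : forall (A B D : pfc_cat) (f : hom A D) (g : hom B D),
    exists (P : pfc_cat) (p1 : hom P A) (p2 : hom P B), is_pullback f g p1 p2
}.

Definition is_zero_morphism (C : category) (A B : C) (f : hom A B) : Prop :=
  exists (O : C) (i : hom O B) (t : hom A O), is_zero_object O /\ f = i ∘ t.

Definition is_mono (C : category) (A B : C) (m : hom A B) : Prop :=
  forall (Q : C) (u v : hom Q A), m ∘ u = m ∘ v -> u = v.

Definition is_iso (C : category) (A B : C) (m : hom A B) : Prop :=
  exists n : hom B A, m ∘ n = idm B /\ n ∘ m = idm A.

Definition is_kernel (C : category) (K A B : C)
    (k : hom K A) (f : hom A B) : Prop :=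
  is_zero_morphism (f ∘ k) /\
  forall (Q : C) (q : hom Q A), is_zero_morphism (f ∘ q) ->
    exists u : hom Q K, k ∘ u = q /\ forall v : hom Q K, k ∘ v = q -> v = u.

Definition jointly_extremal_epimorphic (C : category) (A B D : C)
    (f : hom A D) (g : hom B D) : Prop :=
  forall (M : C) (m : hom M D), is_mono m ->
    (exists f' : hom A M, f = m ∘ f') ->
    (exists g' : hom B M, g = m ∘ g') ->
    is_iso m.

Record point (C : category) (X : C) := Point {
  pt_ob : C;
  pt_map : hom pt_ob X;
  pt_section : hom X pt_ob;
  pt_splits : pt_map ∘ pt_section = idm X
}.

Definition strong (C : category) (X : C) (p : point X) : Prop :=
  forall (K : C) (k : hom K (pt_ob p)), is_kernel k (pt_map p) ->
    jointly_extremal_epimorphic (pt_section p) k.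

(* [q] is the point obtained by pulling [p] back along [g]: the projections are
   [pt_map q] and [p2], and the section of [q] is the arrow <1_Z, s g>. *)
Definition is_pullback_point (C : category) (X Z : C)
    (p : point X) (g : hom Z X) (q : point Z) : Prop :=
  exists p2 : hom (pt_ob q) (pt_ob p),
    is_pullback g (pt_map p) (pt_map q) p2 /\
    p2 ∘ pt_section q = pt_section p ∘ g.

Definition stably_strong (C : category) (X : C) (p : point X) : Prop :=
  forall (Z : C) (g : hom Z X) (q : point Z),
    is_pullback_point p g q -> strong q.

Definition weakly_protomodular (C : pfc_category) (X : C) : Prop :=
  forall p : point X, strong p.

Definition protomodular (C : pfc_category) (X : C) : Prop :=
  forall p : point X, stably_strong p.

Record lpm := Lpm {
  lpm_car :> Type;
  mul : lpm_car -> lpm_car -> lpm_car;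
  ldiv : lpm_car -> lpm_car -> lpm_car;
  lpm_unit : lpm_car;
  mul_ldiv : forall x y : lpm_car, mul x (ldiv x y) = y;
  mul_unitl : forall x : lpm_car, mul lpm_unit x = x;
  mul_unitr : forall x : lpm_car, mul x lpm_unit = x
}.

Arguments mul {l} x y.
Arguments ldiv {l} x y.
Arguments lpm_unit {l}.

Record lpm_hom (A B : lpm) := LpmHom {
  lpm_fun :> A -> B;
  lpm_fun_mul : forall x y : A, lpm_fun (mul x y) = mul (lpm_fun x) (lpm_fun y);
  lpm_fun_ldiv : forall x y : A,
    lpm_fun (ldiv x y) = ldiv (lpm_fun x) (lpm_fun y);
  lpm_fun_unit : lpm_fun lpm_unit = lpm_unit
}.

Lemma lpm_hom_ext (A B : lpm) (f g : lpm_hom A B) :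
  (forall x, f x = g x) -> f = g.
Proof.
  destruct f as [f f1 f2 f3], g as [g g1 g2 g3]; simpl; intros E.
  apply functional_extensionality in E; subst g.
  f_equal; apply proof_irrelevance.
Qed.

Definition lpm_id (A : lpm) : lpm_hom A A.
Proof. now exists (fun x => x). Defined.

Definition lpm_comp (A B C : lpm) (g : lpm_hom B C) (f : lpm_hom A B) :
  lpm_hom A C.
Proof.
  exists (fun x => g (f x)).
  - intros x y; now rewrite !lpm_fun_mul.
  - intros x y; now rewrite !lpm_fun_ldiv.
  - now rewrite !lpm_fun_unit.
Defined.

Definition LPM_cat : category.
Proof.
  refine (@Category lpm lpm_hom lpm_id lpm_comp _ _ _);
    intros; now apply lpm_hom_ext.
Defined.

Definition lpm_one : lpm.
Proof.
  now refine (@Lpm unit (fun _ _ => tt) (fun _ _ => tt) tt _ _ _);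
    intros; repeat match goal with x : unit |- _ => destruct x end.
Defined.

Lemma lpm_one_zero : is_zero_object (lpm_one : LPM_cat).
Proof.
  split; intros A.
  - unshelve eexists.
    + exists (fun _ => lpm_unit); simpl; intros; auto.
      * now rewrite mul_unitl.
      * rewrite <- (mul_unitl (ldiv lpm_unit lpm_unit)); now rewrite mul_ldiv.
    + intros g; apply lpm_hom_ext; intros []; exact (lpm_fun_unit g).
  - unshelve eexists.
    + now exists (fun _ => tt).
    + intros g; apply lpm_hom_ext; intros x; now destruct (g x).
Qed.

Record subalgebra (X : lpm) := Subalgebra {
  sub_mem :> X -> Prop;
  sub_unit : sub_mem lpm_unit;
  sub_mul : forall x y : X, sub_mem x -> sub_mem y -> sub_mem (mul x y);
  sub_ldiv : forall x y : X, sub_mem x -> sub_mem y -> sub_mem (ldiv x y)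
}.

Definition lpm_of_subalgebra (X : lpm) (S : subalgebra X) : lpm.
Proof.
  refine (@Lpm {x : X | S x}
    (fun a b => exist _ (mul (proj1_sig a) (proj1_sig b))
                  (sub_mul (proj2_sig a) (proj2_sig b)))
    (fun a b => exist _ (ldiv (proj1_sig a) (proj1_sig b))
                  (sub_ldiv (proj2_sig a) (proj2_sig b)))
    (exist _ lpm_unit (sub_unit S)) _ _ _);
    intros; apply eq_sig_hprop; try (intros; apply proof_irrelevance); simpl.
  - apply mul_ldiv.
  - apply mul_unitl.
  - apply mul_unitr.
Defined.

Definition lpm_prod (A B : lpm) : lpm.
Proof.
  refine (@Lpm (A * B)%type
    (fun p q => (mul (fst p) (fst q), mul (snd p) (snd q)))
    (fun p q => (ldiv (fst p) (fst q), ldiv (snd p) (snd q)))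
    (lpm_unit, lpm_unit) _ _ _); intros; apply injective_projections; simpl;
    first [apply mul_ldiv | apply mul_unitl | apply mul_unitr].
Defined.

Definition lpm_equalizing (A B D : lpm) (f : lpm_hom A D) (g : lpm_hom B D) :
  subalgebra (lpm_prod A B).
Proof.
  refine (@Subalgebra (lpm_prod A B) (fun p => f (fst p) = g (snd p)) _ _ _);
    simpl; intros.
  - now rewrite !lpm_fun_unit.
  - rewrite !lpm_fun_mul; congruence.
  - rewrite !lpm_fun_ldiv; congruence.
Defined.

Lemma lpm_pullback (A B D : LPM_cat) (f : hom A D) (g : hom B D) :
  exists (P : LPM_cat) (p1 : hom P A) (p2 : hom P B), is_pullback f g p1 p2.
Proof.
  exists (lpm_of_subalgebra (lpm_equalizing f g)).
  unshelve eexists; [now exists (fun p => fst (proj1_sig p))|].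
  unshelve eexists; [now exists (fun p => snd (proj1_sig p))|].
  split.
  - apply lpm_hom_ext; intros [p e]; exact e.
  - intros Q q1 q2 E.
    assert (E' : forall x, f (q1 x) = g (q2 x)).
    { intros x; exact (f_equal (fun h : lpm_hom Q D => h x) E). }
    unshelve eexists.
    + exists (fun x => exist (fun p => f (fst p) = g (snd p))
                         (q1 x, q2 x) (E' x)); intros;
        apply eq_sig_hprop; try (intros; apply proof_irrelevance);
        apply injective_projections; simpl;
        first [apply lpm_fun_mul | apply lpm_fun_ldiv | apply lpm_fun_unit].
    + split; [split; now apply lpm_hom_ext|].
      intros v <- <-; apply lpm_hom_ext; intros x.
      apply eq_sig_hprop; [intros; apply proof_irrelevance|].
      simpl; apply surjective_pairing.
Qed.

Definition LPM : pfc_category :=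
  @PfcCategory LPM_cat (ex_intro _ (lpm_one : LPM_cat) lpm_one_zero) lpm_pullback.

(* Main.v *)
Require Import Defs.
From Stdlib Require Import Classical ClassicalEpsilon ZArith Lia.

Set Implicit Arguments.
Unset Strict Implicit.

(** Call [y] in a subalgebra [S] grounded if some chain
    [y, x1 \ y, x2 \ (x1 \ y), ...] with all [xi] in [S] reaches the unit.  If
    every element of [S] is grounded, then every point over [S] is strong:
    writing [a = s x * (s x \ a)] moves an element [a] of the fibre over [y] to
    the fibre over [x \ y], and eventually into the kernel.  If some element of
    [S] is not grounded, then [X * Z] carries an LPM structure, split over [X],
    whose pullback to [S] is not strong: the pairs [(x, n)] with [n] even
    whenever [x] is an ungrounded element of [S] contain the kernel and the
    section and are closed under the operations over [S]. *)

Inductive grounded (X : lpm) (S : subalgebra X) : X -> Prop :=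
| grounded_unit : grounded S lpm_unit
| grounded_ldiv (x y : X) : S x -> grounded S (ldiv x y) -> grounded S y.

Definition ungrounded (X : lpm) (S : subalgebra X) (x : X) : Prop :=
  S x /\ ~ grounded S x.

Lemma ldiv_unit_eq (X : lpm) (x y : X) : ldiv x y = lpm_unit -> x = y.
Proof.
  intros E; rewrite <- (mul_ldiv x y), E; symmetry; apply mul_unitr.
Qed.

Lemma ldiv_unitl (X : lpm) (x : X) : ldiv lpm_unit x = x.
Proof. now rewrite <- (mul_unitl (ldiv lpm_unit x)), mul_ldiv. Qed.

Lemma ungrounded_unit (X : lpm) (S : subalgebra X) :
  ~ ungrounded S lpm_unit.
Proof. intros [_ H]; apply H; constructor. Qed.

Lemma ungrounded_ldiv (X : lpm) (S : subalgebra X) (x y : X) :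
  S x -> ungrounded S y -> ungrounded S (ldiv x y).
Proof.
  intros Sx [Sy Hy]; split; [now apply sub_ldiv|].
  intros H; apply Hy; now apply grounded_ldiv with x.
Qed.

Definition dec (P : Prop) : {P} + {~ P} := excluded_middle_informative P.

(** * The twisted structure on [X * Z], split over [X] *)

Section Twisted.

Variables (X : lpm) (S : subalgebra X).

Local Open Scope Z_scope.

(* Division leading from a grounded element into an ungrounded one doubles the
   integer, so that the result stays even, and multiplication halves it back.
   Addition over the unit lets [(x, m) \ (x, n) = (unit, n - m)] coexist with
   the right unit law. *)
Definition twisted_mul (p q : X * Z) : X * Z :=
  (mul (fst p) (fst q),
   if dec (fst q = lpm_unit) then
     if dec (ungrounded S (fst p)) then snd p else snd p + snd q
   else if dec (ungrounded S (fst q)) then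
     if dec (ungrounded S (mul (fst p) (fst q))) then snd q else snd q / 2
   else if dec (S (fst p) /\ ungrounded S (mul (fst p) (fst q))) then 0
   else snd q).

Definition twisted_ldiv (p q : X * Z) : X * Z :=
  (ldiv (fst p) (fst q),
   if dec (ldiv (fst p) (fst q) = lpm_unit) then snd q - snd p
   else if dec (ungrounded S (ldiv (fst p) (fst q))) then
     if dec (ungrounded S (fst q)) then snd q else 2 * snd q
   else snd q).

Lemma twisted_mul_ldiv (p q : X * Z) : twisted_mul p (twisted_ldiv p q) = q.
Proof.
  destruct p as [x m], q as [y n]; unfold twisted_mul, twisted_ldiv; cbn [fst snd].
  rewrite mul_ldiv; f_equal.
  destruct (dec (ldiv x y = lpm_unit)) as [e|_].
  (* A unit quotient forces [x = y]; were [x] ungrounded, so would be [x \ x], which is the unit. *)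
  - destruct (dec (ungrounded S x)) as [Ux|_]; [exfalso|ring].
    apply (@ungrounded_unit X S); rewrite <- e.
    rewrite <- (ldiv_unit_eq e); apply ungrounded_ldiv; [apply Ux|exact Ux].
  - destruct (dec (ungrounded S (ldiv x y))) as [_|NU].
    + destruct (dec (ungrounded S y)); [reflexivity|].
      rewrite Z.mul_comm; now apply Z.div_mul.
    (* The branch of [twisted_mul] with value 0 never meets a quotient: for [x] in [S] and [y]
       ungrounded, [x \ y] is ungrounded. *)
    + destruct (dec (S x /\ ungrounded S y)) as [[Sx Uy]|_]; [|reflexivity].
      exfalso; now apply NU, ungrounded_ldiv.
Qed.

Lemma twisted_mul_unitl (p : X * Z) : twisted_mul (lpm_unit, 0) p = p.
Proof.
  destruct p as [x n]; unfold twisted_mul; simpl; rewrite mul_unitl; f_equal.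
  destruct (dec (x = lpm_unit)).
  - destruct (dec (ungrounded S lpm_unit)) as [U|_]; [|reflexivity].
    now destruct (ungrounded_unit U).
  - destruct (dec (ungrounded S x)); [reflexivity|].
    destruct (dec (S lpm_unit /\ ungrounded S x)); tauto.
Qed.

Lemma twisted_mul_unitr (p : X * Z) : twisted_mul p (lpm_unit, 0) = p.
Proof.
  destruct p as [x n]; unfold twisted_mul; simpl; rewrite mul_unitr; f_equal.
  destruct (dec (@lpm_unit X = lpm_unit)); [|tauto].
  destruct (dec (ungrounded S x)); [reflexivity|ring].
Qed.

Definition twisted : lpm :=
  @Lpm (X * Z)%type twisted_mul twisted_ldiv (lpm_unit, 0)
    twisted_mul_ldiv twisted_mul_unitl twisted_mul_unitr.

Definition twisted_proj : lpm_hom twisted X.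
Proof. now exists (fun p : X * Z => fst p). Defined.

Definition twisted_section : lpm_hom X twisted.
Proof.
  exists (fun x => (x, 0)); [| |reflexivity]; intros x y; simpl;
    unfold twisted_mul, twisted_ldiv; simpl; f_equal;
    repeat match goal with |- context [dec ?P] => destruct (dec P) end;
    reflexivity.
Defined.

Definition twisted_point : @point LPM X.
Proof.
  refine (@Point LPM X twisted twisted_proj twisted_section _).
  now apply lpm_hom_ext.
Defined.

Definition ungrounded_even (p : X * Z) : Prop :=
  ungrounded S (fst p) -> Z.Even (snd p).

(** When the left factor lies over [S], the integer over an ungrounded product is that of an
    ungrounded factor, or 0. *)
Lemma ungrounded_even_mul (p q : X * Z) :
  S (fst p) -> ungrounded_even p -> ungrounded_even q ->
  ungrounded_even (twisted_mul p q).
Proof.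
  destruct p as [x m], q as [w n].
  unfold ungrounded_even, twisted_mul; simpl; intros Sx Hm Hn U.
  destruct (dec (w = lpm_unit)) as [->|_].
  - rewrite mul_unitr in U; destruct (dec (ungrounded S x)); tauto.
  - destruct (dec (ungrounded S w)).
    + destruct (dec (ungrounded S (mul x w))); tauto.
    + destruct (dec (S x /\ ungrounded S (mul x w))); [|tauto].
      now exists 0.
Qed.

(** Over an ungrounded quotient the integer is kept if the dividend is ungrounded, hence already
    even, and doubled otherwise. *)
Lemma ungrounded_even_ldiv (p q : X * Z) :
  ungrounded_even q -> ungrounded_even (twisted_ldiv p q).
Proof.
  destruct p as [x m], q as [y n].
  unfold ungrounded_even, twisted_ldiv; simpl; intros Hn U.
  destruct (dec (ldiv x y = lpm_unit)) as [e|_].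
  - rewrite e in U; now destruct (ungrounded_unit U).
  - destruct (dec (ungrounded S (ldiv x y))); [|tauto].
    destruct (dec (ungrounded S y)); [tauto|now exists n].
Qed.

End Twisted.

(** * Kernels, monomorphisms and isomorphisms of [LPM] in terms of elements *)

Definition sub_incl (X : lpm) (S : subalgebra X) :
  lpm_hom (lpm_of_subalgebra S) X.
Proof. now exists (fun x : {x : X | S x} => proj1_sig x). Defined.

Lemma sub_incl_inj (X : lpm) (S : subalgebra X) (a b : lpm_of_subalgebra S) :
  sub_incl S a = sub_incl S b -> a = b.
Proof. apply eq_sig_hprop; intros; apply proof_irrelevance. Qed.

Definition sub_corestrict (A X : lpm) (S : subalgebra X) (f : lpm_hom A X)
  (Hf : forall a, S (f a)) : lpm_hom A (lpm_of_subalgebra S).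
Proof.
  exists (fun a => exist _ (f a) (Hf a) : lpm_of_subalgebra S);
    intros; apply sub_incl_inj; simpl;
    first [apply lpm_fun_mul | apply lpm_fun_ldiv | apply lpm_fun_unit].
Defined.

Definition kernel_sub (A B : lpm) (f : lpm_hom A B) : subalgebra A.
Proof.
  refine (@Subalgebra A (fun a => f a = lpm_unit) _ _ _).
  - apply lpm_fun_unit.
  - intros x y Hx Hy; now rewrite lpm_fun_mul, Hx, Hy, mul_unitl.
  - intros x y Hx Hy; now rewrite lpm_fun_ldiv, Hx, Hy, ldiv_unitl.
Defined.

Lemma comp_apply (A B D : LPM) (g : hom B D) (f : hom A B) (h : hom A D)
  (x : (A : lpm)) :
  g ∘ f = h -> (g : lpm_hom B D) ((f : lpm_hom A B) x) = (h : lpm_hom A D) x.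
Proof. now intros <-. Qed.

Lemma zero_morphism_iff (A B : LPM) (f : hom A B) :
  is_zero_morphism f <-> forall a, (f : lpm_hom A B) a = lpm_unit.
Proof.
  split.
  - intros (O & i & t & [_ HO] & ->) a; simpl.
    destruct (HO O) as [v Hv].
    (* A zero object has a single endomorphism, so its identity is the constant map [z], and
       whatever factors through it is constant. *)
    pose (z := @LpmHom O O (fun _ => lpm_unit)
      (fun _ _ => eq_sym (mul_unitl _)) (fun _ _ => eq_sym (ldiv_unitl _))
      eq_refl).
    assert (E : lpm_id O = z) by now rewrite (Hv (lpm_id O)), (Hv z).
    transitivity ((i : lpm_hom O B) (lpm_id O ((t : lpm_hom A O) a))).
    + reflexivity.
    + rewrite E; apply lpm_fun_unit.
  - intros H.
    destruct lpm_one_zero as [I T].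
    destruct (I B) as [i _], (T A) as [t _].
    exists (lpm_one : LPM), i, t; split; [exact lpm_one_zero|].
    apply lpm_hom_ext; intros a; rewrite H; simpl.
    destruct ((t : lpm_hom A lpm_one) a); symmetry; exact (lpm_fun_unit i).
Qed.

Lemma kernel_sub_is_kernel (A B : LPM) (f : hom A B) :
  @is_kernel LPM (lpm_of_subalgebra (kernel_sub f)) A B
    (sub_incl (kernel_sub f)) f.
Proof.
  split.
  - apply zero_morphism_iff; intros a; exact (proj2_sig a).
  - intros Q q Hq.
    exists (sub_corestrict (S := kernel_sub f) (proj1 (zero_morphism_iff _) Hq)).
    split; [now apply lpm_hom_ext|].
    intros v Hv; apply lpm_hom_ext; intros a; apply sub_incl_inj.
    exact (comp_apply a Hv).
Qed.

(** The concrete kernel [kernel_sub f] factors through the arbitrary kernel [k]. *)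
Lemma kernel_surj (K A B : LPM) (k : hom K A) (f : hom A B) (a : (A : lpm)) :
  is_kernel k f -> (f : lpm_hom A B) a = lpm_unit ->
  exists b, (k : lpm_hom K A) b = a.
Proof.
  intros [_ Hk] Ha.
  destruct (Hk _ _ (proj1 (kernel_sub_is_kernel f))) as (u & Hu & _).
  exists ((u : lpm_hom _ _) (exist _ a Ha : lpm_of_subalgebra (kernel_sub f))).
  exact (comp_apply (exist _ a Ha : lpm_of_subalgebra (kernel_sub f)) Hu).
Qed.

(** The two projections of the kernel pair of [m] agree after [m], hence coincide. *)
Lemma mono_inj (A B : LPM) (m : hom A B) :
  is_mono m -> forall a b, (m : lpm_hom A B) a = (m : lpm_hom A B) b -> a = b.
Proof.
  intros Hm a b E.
  pose (P := lpm_of_subalgebra (lpm_equalizing m m)).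
  pose (p1 := ltac:(now exists (fun p => fst (proj1_sig p))) : lpm_hom P A).
  pose (p2 := ltac:(now exists (fun p => snd (proj1_sig p))) : lpm_hom P A).
  assert (E12 : p1 = p2).
  { apply (Hm P p1 p2), lpm_hom_ext; intros p; exact (proj2_sig p). }
  pose (x := exist _ (a, b) E : P).
  exact (f_equal (fun h : lpm_hom P A => h x) E12).
Qed.

Lemma sub_incl_mono (X : lpm) (S : subalgebra X) :
  @is_mono LPM (lpm_of_subalgebra S) X (sub_incl S).
Proof.
  intros Q u v E; apply lpm_hom_ext; intros a; apply sub_incl_inj.
  exact (comp_apply a E).
Qed.

Lemma bijective_iso (A B : LPM) (m : hom A B) :
  (forall a b, (m : lpm_hom A B) a = (m : lpm_hom A B) b -> a = b) ->
  (forall b, exists a, (m : lpm_hom A B) a = b) -> is_iso m.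
Proof.
  intros inj surj.
  pose (n b := proj1_sig (constructive_indefinite_description _ (surj b))).
  assert (mn : forall b, (m : lpm_hom A B) (n b) = b).
  { intros b; exact (proj2_sig (constructive_indefinite_description _ (surj b))). }
  unshelve eexists.
  - exists n; intros; apply inj; rewrite mn; symmetry.
    + now rewrite lpm_fun_mul, !mn.
    + now rewrite lpm_fun_ldiv, !mn.
    + apply lpm_fun_unit.
  - split; apply lpm_hom_ext; intros x; simpl; [apply mn|apply inj, mn].
Qed.

(** * Groundedness suffices for weak protomodularity *)

Lemma grounded_weakly_protomodular (X : lpm) (S : subalgebra X) :
  (forall x, S x -> grounded S x) ->
  weakly_protomodular (lpm_of_subalgebra S : LPM).
Proof.
  intros G [A f s fs] K k Hk M m Hm [s' Hs] [k' Hk']; simpl in *.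
  apply bijective_iso; [now apply mono_inj|].
  (* Surjectivity of [m] is proved for a whole fibre at once, because the induction replaces [a] by
     [s z \ a], which lies in another fibre. *)
  enough (H : forall x, grounded S x -> forall a, proj1_sig (f a) = x ->
            exists b, m b = a).
  { intros a; apply (H (proj1_sig (f a))); [|reflexivity].
    apply G; exact (proj2_sig (f a)). }
  induction 1 as [|x y Sx _ IH]; intros a Ha.
  - destruct (@kernel_surj _ _ _ _ _ a Hk) as [b <-].
    + now apply sub_incl_inj.
    + exists (k' b); now rewrite Hk'.
  - pose (z := exist _ x Sx : lpm_of_subalgebra S).
    destruct (IH (ldiv (s z) a)) as [b Hb].
    + rewrite lpm_fun_ldiv.
      replace (f (s z)) with z by (symmetry; exact (comp_apply z fs)).
      simpl; now rewrite Ha.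
    + exists (mul (s' z) b); rewrite lpm_fun_mul, Hb.
      replace (m (s' z)) with (s z) by now rewrite Hs.
      apply mul_ldiv.
Qed.

(** * Protomodularity forces groundedness *)

Definition over_even (X P : lpm) (S : subalgebra X)
  (p1 : lpm_hom P (lpm_of_subalgebra S)) (p2 : lpm_hom P (twisted S))
  (E : forall a, sub_incl S (p1 a) = twisted_proj S (p2 a)) : subalgebra P.
Proof.
  refine (@Subalgebra P (fun a => ungrounded_even S (p2 a)) _ _ _).
  - rewrite lpm_fun_unit; intros _; now exists 0%Z.
  - intros a b Ha Hb; rewrite lpm_fun_mul; apply ungrounded_even_mul; auto.
    (* Compatibility [E] puts the first coordinate of [p2 a] in [S], as closure under products
       requires. *)
    change (S (twisted_proj S (p2 a))); rewrite <- E; exact (proj2_sig (p1 a)).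
  - intros a b Ha Hb; rewrite lpm_fun_ldiv; now apply ungrounded_even_ldiv.
Defined.

Lemma protomodular_grounded (X : LPM) (S : subalgebra X) :
  protomodular X -> forall x, S x -> grounded S x.
Proof.
  intros HX x Sx; apply NNPP; intros Gx.
  destruct (@lpm_pullback (lpm_of_subalgebra S) (twisted S) X
    (sub_incl S) (twisted_proj S)) as (P & p1 & p2 & HP).
  (* [t] is the section of the pulled-back point, induced by the identity and the twisted
     section. *)
  destruct (proj2 HP (lpm_of_subalgebra S) (lpm_id _)
    (lpm_comp (twisted_section S) (sub_incl S))) as (t & [t1 t2] & _).
  { now apply lpm_hom_ext. }
  pose (q := @Point LPM (lpm_of_subalgebra S) P p1 t t1).
  assert (E := fun a => comp_apply a (proj1 HP)).
  pose (N := over_even (p1 := p1) (p2 := p2) E).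
  assert (iso : @is_iso LPM (lpm_of_subalgebra N) P (sub_incl N)).
  { refine (HX (twisted_point S) _ (sub_incl S) q _ _ _
      (kernel_sub_is_kernel p1) _ _ (@sub_incl_mono P N) _ _).
    - exists p2; split; [exact HP|exact t2].
    - assert (Ht : forall a, N ((t : lpm_hom _ _) a)).
      { intros a _; exists 0%Z.
        exact (f_equal snd (comp_apply a t2)). }
      exists (sub_corestrict Ht); now apply lpm_hom_ext.
    - assert (Hk : forall a, N (sub_incl (kernel_sub p1) a)).
      { intros [a Ha] U; exfalso; simpl in U.
        change (ungrounded S (twisted_proj S ((p2 : lpm_hom _ _) a))) in U.
        change ((p1 : lpm_hom _ _) a = lpm_unit) in Ha.
        apply (@ungrounded_unit X S).
        assert (Ea := E a); simpl in Ea, U; rewrite <- Ea, Ha in U; exact U. }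
      exists (sub_corestrict Hk); now apply lpm_hom_ext. }
  destruct iso as (n & Hn & _).
  (* [P] is known only by its universal property; the concrete pullback [Q] maps into it and so
     supplies an element of [P] over [(x, 1)], odd above the ungrounded [x]. *)
  pose (Q := lpm_of_subalgebra (lpm_equalizing (sub_incl S) (twisted_proj S))).
  pose (q1 := ltac:(now exists (fun p => fst (proj1_sig p)))
    : lpm_hom Q (lpm_of_subalgebra S)).
  pose (q2 := ltac:(now exists (fun p => snd (proj1_sig p)))
    : lpm_hom Q (twisted S)).
  destruct (proj2 HP Q q1 q2) as (u & [_ u2] & _).
  { apply lpm_hom_ext; intros p; exact (proj2_sig p). }
  pose (c := exist _ (exist _ x Sx : lpm_of_subalgebra S, (x, 1%Z) : twisted S)
    eq_refl : Q).
  (* The right inverse [n] of the inclusion puts every element of [P] in [N]. *)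
  assert (Nc : N ((u : lpm_hom _ _) c)).
  { rewrite <- (comp_apply ((u : lpm_hom _ _) c) Hn : _ = (u : lpm_hom _ _) c).
    apply (proj2_sig ((n : lpm_hom _ _) ((u : lpm_hom _ _) c))). }
  assert (Uc : (p2 : lpm_hom _ _) ((u : lpm_hom _ _) c) = (x, 1%Z)).
  { exact (comp_apply c u2). }
  unfold N in Nc; simpl in Nc; unfold ungrounded_even in Nc.
  rewrite Uc in Nc; destruct Nc as [z Hz]; [now split|].
  cbn [snd] in Hz; lia.
Qed.

Theorem theorem2p9 (X : LPM) (S : subalgebra X) :
  protomodular X -> weakly_protomodular (lpm_of_subalgebra S : LPM).
Proof.
  intros HX; now apply grounded_weakly_protomodular, protomodular_grounded.
Qed.
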